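(* Let $\lambda=(s,2)$ with $s\ge2$. Then, as operators on $\mathbf F$, \[ s_\lambda(\mathbf u)=\sum_T u_{\mathrm{reading}(T)}, \] where the sum is over all $n$-commuting tableaux $T$ of shape $(s,2)$.
   Context: Fix an integer $n\ge 1$. Partitions are drawn in English notation; the box in row $r$ and column $c$ lies on diagonal $c-r$. An $n$-ribbon is a connected skew shape with $n$ boxes containing no $2\times 2$ square; its head is its top-right box, and its spin is its number of rows minus $1$. Let $K=\mathbb{C}(q)$ and let $\mathbf F$ be the $K$-vector space with basis the set of all partitions. For $i\in\mathbb{Z}$, $u_i\in\mathrm{End}_K(\mathbf F)$ is defined by $u_i(\lambda)=q^{\mathrm{spin}(\mu/\lambda)}\mu$ if there is a partition $\mu$ with $\mu/\lambda$ an $n$-ribbon with head on diagonal $i$, else $0$. Let $h_k(\mathbf u)=\sum_{i_1<\cdots<i_k}u_{i_k}\cdots u_{i_1}$, $h_0(\mathbf u)=1$, $h_k(\mathbf u)=0$ for $k<0$; these operators pairwise commute, and $s_\lambda(\mathbf u)=\det\big(h_{\lambda_i-i+j}(\mathbf u)\big)_{i,j=1}^{\ell(\lambda)}$. A filling $T$ of the shape $(s,2)$ by integers, with $T(x,y)$ the entry in row $x$ and column $y$ (indices starting at 1), is $n$-commuting if: (1) rows are strictly increasing: $T(x,y)<T(x,y+1)$; (2) $T(1,2)\le T(2,2)$; (3) either $T(1,1)>T(2,1)$ and $T(2,2)-T(2,1)\le n$, or $T(1,1)<T(2,1)$ and either $T(1,2)\le T(2,1)$, or both $T(1,2)>T(2,1)$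 and $T(2,2)-T(1,1)>n$. The reading word $\mathrm{reading}(T)$ reads the first row from right to left and then the second row from right to left; for a word $w=w_1\cdots w_k$ put $u_w=u_{w_1}\cdots u_{w_k}$. Infinite sums of operators here are well defined since only finitely many terms act nontrivially on a given partition. *)

(* Defs.v *)
From HB Require Import structures.
From mathcomp Require Import all_boot all_order all_algebra.
From mathcomp Require Import finmap.
From mathcomp Require Import boolp classical_sets cardinality fsbigop reals.
From mathcomp Require Import complex zify.
From mathcomp Require Import monalg.

Set Implicit Arguments.
Unset Strict Implicit.
Unset Printing Implicit Defensive.

Import Order.TTheory GRing.Theory Num.Theory.
Local Open Scope ring_scope.

Definition is_intpart (s : seq nat) := sorted geq s && (0%N \notin s).

Definition intpart := {s : seq nat | is_intpart s}.
HB.instance Definition _ := Choice.on intpart.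

Definition part (la : intpart) (i : nat) : nat := nth 0%N (val la) i.

(* Boxes are (row, column), both counted from 0; diagonals are unaffected. *)
Definition box := (nat * nat)%type.

Definition diagram (la : intpart) : seq box :=
  [seq (r, c) | r <- iota 0 (size (val la)), c <- iota 0 (part la r)].

Definition skew (mu la : intpart) : seq box :=
  [seq b <- diagram mu | b \notin diagram la].

Definition diagonal (b : box) : int := (b.2)%:Z - (b.1)%:Z.

Definition adjacent (b b' : box) : bool :=
  (b.1 == b'.1) && ((b'.2 == b.2.+1) || (b.2 == b'.2.+1))
  || (b.2 == b'.2) && ((b'.1 == b.1.+1) || (b.1 == b'.1.+1)).

Definition box_connected (s : seq box) : Prop :=
  forall b b' : box, b \in s -> b' \in s ->
  exists p : seq box, [/\ path adjacent b p, {subset p <= s} & last b p = b'].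

Definition no_square (s : seq box) : Prop :=
  forall r c : nat,
  ~ {subset [:: (r, c); (r, c.+1); (r.+1, c); (r.+1, c.+1)] <= s}.

Definition is_ribbon (n : nat) (mu la : intpart) : Prop :=
  [/\ {subset diagram la <= diagram mu}, size (skew mu la) = n,
      box_connected (skew mu la) & no_square (skew mu la)].

Definition is_head (b : box) (s : seq box) : Prop :=
  b \in s /\ forall b' : box, b' \in s -> (b.1 <= b'.1)%N /\ (b'.2 <= b.2)%N.

Definition spin (s : seq box) : nat := (size (undup [seq b.1 | b <- s])).-1.

Definition adds_ribbon (n : nat) (i : int) (la mu : intpart) : Prop :=
  is_ribbon n mu la /\ exists2 b, is_head b (skew mu la) & diagonal b = i.

(* The possibly noncommutative ring End_K(V), with composition as product. *)
Section Endomorphisms.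
Variables (K : comPzRingType) (V : lmodType K).

Definition endo := {linear V -> V}.

HB.instance Definition _ := gen_eqMixin endo.
HB.instance Definition _ := gen_choiceMixin endo.

Lemma endoP (f g : endo) : (forall x, f x = g x) <-> f = g.
Proof.
split=> [efg|-> //]; case: f g efg => [f [[fa] [fs]]] [g [[ga] [gs]]] /= efg.
have {efg} e : f = g by apply/funext.
subst g.
by rewrite (Prop_irrelevance fa ga) (Prop_irrelevance fs gs).
Qed.

Let eadd (f g : endo) : endo := f \+ g.
Let eopp (f : endo) : endo := \- f.
Let ezero : endo := \0.
Let eone : endo := idfun.
Let emul (f g : endo) : endo := f \o g.

Fact eaddA : associative eadd.
Proof. by move=> f g h; apply/endoP => x /=; rewrite addrA. Qed.
Fact eaddC : commutative eadd.
Proof. by move=> f g; apply/endoP => x /=; rewrite addrC. Qed.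
Fact eadd0 : left_id ezero eadd.
Proof. by move=> f; apply/endoP => x /=; rewrite add0r. Qed.
Fact eaddN : left_inverse ezero eopp eadd.
Proof. by move=> f; apply/endoP => x /=; rewrite addNr. Qed.
Fact emulA : associative emul.
Proof. by move=> f g h; apply/endoP => x. Qed.
Fact emul1 : left_id eone emul.
Proof. by move=> f; apply/endoP => x. Qed.
Fact emulr1 : right_id eone emul.
Proof. by move=> f; apply/endoP => x. Qed.
Fact emulDl : left_distributive emul eadd.
Proof. by move=> f g h; apply/endoP => x. Qed.
Fact emulDr : right_distributive emul eadd.
Proof. by move=> f g h; apply/endoP => x /=; rewrite raddfD. Qed.

HB.instance Definition _ := GRing.isPzRing.Build endo
  eaddA eaddC eadd0 eaddN emulA emul1 emulr1 emulDl emulDr.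

Lemma endo_mulE (f g : endo) x : (f * g) x = f (g x). Proof. by []. Qed.
Lemma endo_addE (f g : endo) x : (f + g) x = f x + g x. Proof. by []. Qed.
Lemma endo_oppE (f : endo) x : (- f) x = - f x. Proof. by []. Qed.
Lemma endo_1E x : (1 : endo) x = x. Proof. by []. Qed.
Lemma endo_0E x : (0 : endo) x = 0. Proof. by []. Qed.

End Endomorphisms.

Definition fock (K : fieldType) := {malg K[intpart]}.
HB.instance Definition _ (K : fieldType) := GRing.Lmodule.on (fock K).

Section LinearExtension.
Variables (K : fieldType) (g : intpart -> fock K).

Definition linext_fun (x : fock K) : fock K :=
  \sum_(la <- msupp x) x@_la *: g la.

Fact linext_is_linear : linear linext_fun.
Proof.
have big (x : fock K) (d : {fset intpart}) : (msupp x `<=` d)%fset ->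
    linext_fun x = \sum_(la <- d) x@_la *: g la.
  move=> sxd; rewrite /linext_fun (big_fset_incl _ sxd) // => la _ la_x.
  by rewrite mcoeff_outdom ?scale0r.
move=> a x y; pose d := (msupp x `|` msupp y)%fset.
rewrite (big _ d) ?(big x d) ?(big y d) ?fsubsetUl ?fsubsetUr //; last first.
  apply: (fsubset_trans (msuppD_le _ _)).
  by apply: fsetSU; exact: msuppZ_le.
rewrite scaler_sumr -big_split /=; apply: eq_bigr => la _.
by rewrite mcoeffD mcoeffZ scalerDl scalerA.
Qed.

HB.instance Definition _ :=
  GRing.isLinear.Build K (fock K) (fock K) *:%R linext_fun linext_is_linear.

Definition linext : endo (fock K) := linext_fun.

Lemma linextE (la : intpart) : linext << la >> = g la.
Proof.
have e : msupp (<< la >> : fock K) = [fset la]%fset by rewrite msuppU oner_eq0.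
by rewrite /= /linext_fun e big_seq_fset1 mcoeffUU scale1r.
Qed.

End LinearExtension.

Section RibbonSchur.
Variables (K : fieldType) (q : K) (n : nat).
Local Open Scope classical_set_scope.

(* There is at most one such mu, so the choice made by cid is immaterial. *)
Definition u_basis (i : int) (la : intpart) : fock K :=
  match pselect (exists mu, adds_ribbon n i la mu) with
  | left h => let mu := projT1 (cid h) in << q ^+ spin (skew mu la) *g mu >>
  | right _ => 0
  end.

Definition u_op (i : int) : endo (fock K) := linext (u_basis i).

Definition u_word (w : seq int) : endo (fock K) := \prod_(i <- w) u_op i.

(* Sum of a possibly infinite family of operators: on each partition only the
   terms not vanishing there are added up. By fsbigop's convention the sum would
   be 0 if there were infinitely many; h_nat_locally_finite and
   reading_locally_finite exclude this for the two families used here. *)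
Definition opsum (T : choiceType) (A : set T) (f : T -> endo (fock K)) :
  endo (fock K) := linext (fun la => \sum_(t \in A) f t << la >>).

Definition h_nat (k : nat) : endo (fock K) :=
  opsum [set t : k.-tuple int | sorted <%R t] (fun t => u_word (rev t)).

Definition h_op (k : int) : endo (fock K) :=
  match k with Posz k' => h_nat k' | Negz _ => 0 end.

(* \det is the Leibniz formula in the noncommutative ring of operators; the
   entries pairwise commute. *)
Definition schur (la : intpart) : endo (fock K) :=
  \det (\matrix_(i < size (val la), j < size (val la))
          h_op ((part la i)%:Z - i%:Z + j%:Z)).

(* A filling of the shape (s, 2): its first and its second row. *)
Definition filling (s : nat) := (s.-tuple int * 2.-tuple int)%type.
HB.instance Definition _ s := Choice.on (filling s).

(* The entry in row x and column y, both counted from 1. *)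
Definition entry (s : nat) (T : filling s) (x y : nat) : int :=
  if x == 1%N then nth 0 T.1 y.-1 else nth 0 T.2 y.-1.

Definition n_commuting (s : nat) (T : filling s) : Prop :=
  [/\ (forall y, (1 <= y < s)%N -> entry T 1 y < entry T 1 y.+1)
        /\ entry T 2 1 < entry T 2 2,
      entry T 1 2 <= entry T 2 2
    & (entry T 1 1 > entry T 2 1 /\ entry T 2 2 - entry T 2 1 <= n%:Z)
      \/ (entry T 1 1 < entry T 2 1 /\
          (entry T 1 2 <= entry T 2 1 \/
           (entry T 1 2 > entry T 2 1 /\ entry T 2 2 - entry T 1 1 > n%:Z)))].

Definition reading (s : nat) (T : filling s) : seq int := rev T.1 ++ rev T.2.

Lemma size_diagram_ge (mu : intpart) (b : box) : b \in diagram mu ->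
  (b.1 < size (diagram mu))%N /\ (b.2 < size (diagram mu))%N.
Proof.
case: b => r c /allpairsPdep[r' [c' [rP cP [-> ->]]]] /=.
move: rP cP; rewrite !mem_iota !add0n !leq0n /= => rP cP.
have pos k : (k < size (val mu))%N -> (0 < part mu k)%N.
  move=> kP; rewrite lt0n; apply/eqP => e.
  by have /andP[_ /negP[]] := valP mu; rewrite -e; exact: mem_nth.
have inj (S : seq box) : uniq S -> {subset S <= diagram mu} ->
  (size S <= size (diagram mu))%N by move=> US; exact: uniq_leq_size US.
have inD a d : (a < size (val mu))%N -> (d < part mu a)%N ->
    (a, d) \in diagram mu.
  by move=> aP dP; apply: allpairs_f_dep; rewrite mem_iota.
split.
- apply: leq_trans rP _; rewrite -[X in (X <= _)%N](size_iota 0).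
  rewrite -(size_map (fun k => (k, 0%N) : box)); apply: inj.
    by rewrite map_inj_uniq ?iota_uniq // => x y [].
  move=> b /mapP[k]; rewrite mem_iota add0n => /andP[_ kP] ->.
  by apply: inD => //; exact: pos.
- apply: leq_trans cP _; rewrite -[X in (X <= _)%N](size_iota 0).
  rewrite -(size_map (fun k => (r', k) : box)); apply: inj.
    by rewrite map_inj_uniq ?iota_uniq // => x y [].
  by move=> b /mapP[k]; rewrite mem_iota add0n => /andP[_ kP] ->; exact: inD.
Qed.

Lemma diagram_uniq (mu : intpart) : uniq (diagram mu).
Proof.
apply: allpairs_uniq_dep => [|r _|]; rewrite ?iota_uniq //.
by move=> [a b] [c d] /= _ _ [-> ->].
Qed.

Lemma adds_ribbon_bound (i : int) (la mu : intpart) :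
  adds_ribbon n i la mu -> (`|i| < size (diagram la) + n)%N.
Proof.
move=> [[sub sz _ _] [b [bs _] <-]].
have /size_diagram_ge[b1 b2] : b \in diagram mu.
  by move: bs; rewrite mem_filter => /andP[].
have : (size (diagram mu) <= size (diagram la) + n)%N.
  rewrite -sz -(count_predC (mem (diagram la))) -!size_filter leq_add2r.
  apply: uniq_leq_size; first by rewrite filter_uniq ?diagram_uniq.
  by move=> x; rewrite mem_filter => /andP[].
rewrite /diagonal => ?; lia.
Qed.

Lemma u_op_locally_finite (x : fock K) : finite_set [set i : int | u_op i x != 0].
Proof.
pose N := (\max_(la <- msupp x) (size (diagram la) + n))%N.
apply: (@sub_finite_set _ _
  [set` [seq (k%:Z - N%:Z) | k <- iota 0 (N + N)]]); last exact: finite_seq.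
move=> i /= ui.
have iN : (`|i| < N)%N.
  rewrite ltnNge; apply: contraNN ui => Ni; apply/eqP.
  rewrite /= /linext_fun big_seq big1 // => la la_x.
  rewrite /u_basis; case: pselect => [h|_]; last by rewrite scaler0.
  have := adds_ribbon_bound (projT2 (cid h)); rewrite ltnNge => /negP[].
  apply: leq_trans Ni.
  rewrite /N (big_rem la la_x) /=; exact: leq_maxl.
apply/mapP; exists (absz (i + N%:Z)%R); [rewrite mem_iota|]; lia.
Qed.

Lemma u_word_locally_finite (k : nat) (x : fock K) :
  finite_set [set w : seq int | size w = k /\ u_word w x != 0].
Proof.
elim: k => [|k IHk].
  by apply: (@sub_finite_set _ _ [set [::]]) => // w [/size0nil].
apply: (@sub_finite_set _ _ (\bigcup_(w in [set w : seq int | size w = k /\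
    u_word w x != 0]) [set i :: w | i in [set i | u_op i (u_word w x) != 0]])).
  case=> [[]//|i w] [/= [sw]]; rewrite /u_word big_cons endo_mulE => uw.
  exists w; last by exists i.
  by split=> //; apply: contraNneq uw => ->; rewrite raddf0.
apply: bigcup_finite => // w _.
by apply: finite_image; exact: u_op_locally_finite.
Qed.

Lemma h_nat_locally_finite (k : nat) (x : fock K) :
  finite_set [set t : k.-tuple int | u_word (rev t) x != 0].
Proof.
have inj : injective (fun t : k.-tuple int => rev t).
  by move=> t t' /(congr1 rev); rewrite !revK; exact: val_inj.
apply: sub_finite_set (finite_preimage (in2W inj) (u_word_locally_finite k x)).
by move=> t /= tx; rewrite size_rev size_tuple.
Qed.

Lemma reading_locally_finite (s : nat) (x : fock K) :
  finite_set [set T : filling s | u_word (reading T) x != 0].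
Proof.
have inj : injective (@reading s).
  move=> [a b] [a' b'] /eqP; rewrite /reading /= eqseq_cat ?size_rev ?size_tuple //.
  by move=> /andP[/eqP/(can_inj revK)/val_inj -> /eqP/(can_inj revK)/val_inj ->].
apply: sub_finite_set
  (finite_preimage (in2W inj) (u_word_locally_finite (s + 2) x)).
by move=> T /= Tx; rewrite size_cat !size_rev !size_tuple.
Qed.

End RibbonSchur.

Definition ratfun (R : realType) := {fraction {poly R[i]}}.
HB.instance Definition _ (R : realType) := GRing.Field.on (ratfun R).

Definition qvar (R : realType) : ratfun R := tofrac 'X.

(* Main.v *)
(* Encode a partition la by its beads, the integers la_r - r (rows counted from
   0). Adding an n-ribbon with head on diagonal i moves a bead from i + 1 - n to
   the free position i + 1, and the spin is the number of beads jumped over.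
   This gives u_i u_j u_i = u_i^2 = 0, u_i u_j = u_j u_i for |i - j| > n and
   u_i u_j = q^2 u_j u_i for 0 < i - j < n, hence, for x < y < z <= x + n,
   u_x u_z u_y = u_y u_x u_z and u_y u_z u_x = u_z u_x u_y.

   Here s_(s,2) = h_s h_2 - h_(s+1) h_1, and h_s h_2 is the sum over all fillings
   with increasing rows, so the fillings that are not n-commuting have to add up
   to h_(s+1) h_1. Only the first two letters of the first row matter; the
   relations above match the words, using h_1 h_2 = h_2 h_1 over the letters
   smaller than a given one. On a fixed vector only finitely many words act
   nontrivially, so it is enough to prove this for a finite interval of
   letters. *)

From HB Require Import structures.
From mathcomp Require Import all_boot all_order all_algebra fingroup perm.
From mathcomp Require Import finmap.
From mathcomp Require Import boolp classical_sets cardinality fsbigop reals.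
From mathcomp Require Import zify.
From mathcomp Require Import monalg.
Require Import Defs.

Set Implicit Arguments.
Unset Strict Implicit.
Unset Printing Implicit Defensive.

Import Order.TTheory GRing.Theory Num.Theory.
Local Open Scope ring_scope.

(** * Ribbons as bead moves *)

Lemma part_gt0 (la : intpart) (r : nat) : (0 < part la r)%N = (r < size (val la))%N.
Proof.
have [rs|rs] := ltnP r (size (val la)); last by rewrite /part nth_default.
rewrite lt0n; apply/eqP => e.
by have /andP[_ /negP[]] := valP la; rewrite -e; exact: mem_nth.
Qed.

Lemma part_homo (la : intpart) (i j : nat) : (i <= j)%N -> (part la j <= part la i)%N.
Proof.
move=> ij; have [js|js] := ltnP j (size (val la)); last by rewrite /part nth_default.
have /andP[so _] := valP la.
have tr : transitive geq by move=> x y z; rewrite /=; lia.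
apply: (sorted_leq_nth tr _ 0%N so) => //.
  by move=> x; exact: leqnn.
by rewrite inE; exact: leq_ltn_trans js.
Qed.

Lemma eq_part (la mu : intpart) : part la =1 part mu -> la = mu.
Proof.
move=> e; apply/val_inj/(@eq_from_nth _ 0%N) => [|i _]; last exact: e.
have h r : (r < size (val la))%N = (r < size (val mu))%N by rewrite -!part_gt0 e.
by have := h (size (val la)); have := h (size (val mu)); rewrite !ltnn; lia.
Qed.

(** Produces a partition from prescribed row lengths, as needed for the result of a bead move; the
    list of parts stops at the first zero of [f]. *)
Lemma intpart_of (f : nat -> nat) :
  (forall i j, (i <= j)%N -> (f j <= f i)%N) -> (exists k, f k == 0%N) ->
  exists la : intpart, part la =1 f.
Proof.
move=> fh fz; case: (ex_minnP fz) => N /eqP fN Nmin.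
have pos k : (k < N)%N -> (0 < f k)%N.
  by move=> kN; rewrite lt0n; apply: contraL kN => /Nmin; rewrite -leqNgt.
have is_p : is_intpart (mkseq f N).
  apply/andP; split.
    apply/(sortedP 0%N) => i; rewrite size_mkseq => iN.
    by rewrite !nth_mkseq ?(ltnW iN) //=; apply: fh.
  apply/mapP => -[k]; rewrite mem_iota add0n => /andP[_ /pos]; lia.
exists (exist _ (mkseq f N) is_p) => r; rewrite /part /=.
have [rN|rN] := ltnP r N; first by rewrite nth_mkseq.
rewrite nth_default ?size_mkseq //; have := fh _ _ rN; lia.
Qed.

Lemma mem_diagram (la : intpart) (r c : nat) :
  ((r, c) \in diagram la) = (c < part la r)%N.
Proof.
apply/allpairsPdep/idP => [[r' [c' [rP cP [-> ->]]]]|cr].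
  by move: cP; rewrite mem_iota.
exists r, c; rewrite !mem_iota /= add0n -part_gt0 cr; split=> //.
exact: leq_ltn_trans cr.
Qed.

Lemma mem_skew (mu la : intpart) (r c : nat) :
  ((r, c) \in skew mu la) = (part la r <= c < part mu r)%N.
Proof. by rewrite mem_filter !mem_diagram -leqNgt. Qed.

Lemma subset_diagramP (la mu : intpart) :
  {subset diagram la <= diagram mu} <-> (forall r, part la r <= part mu r)%N.
Proof.
split=> [sub r|h [r c]]; last by rewrite !mem_diagram => /leq_trans; apply.
case e : (part la r) => [//|k].
by rewrite -mem_diagram sub // mem_diagram e.
Qed.

Lemma size_diagram (la : intpart) (N : nat) : (size (val la) <= N)%N ->
  size (diagram la) = (\sum_(r < N) part la r)%N.
Proof.
move=> sN; rewrite size_allpairs_dep sumnE big_map.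
rewrite -(big_mkord xpredT (part la)) (big_cat_nat (leq0n _) sN) //=.
rewrite [X in _ = (_ + X)%N]big_nat_cond [X in _ = (_ + X)%N]big1 ?addn0; last first.
  by move=> r; rewrite andbT => /andP[sr _]; rewrite /part nth_default.
by rewrite /index_iota subn0; apply: eq_bigr => r _; rewrite size_iota.
Qed.

Lemma size_skew (mu la : intpart) (N : nat) :
  (forall r, part la r <= part mu r)%N -> (size (val mu) <= N)%N ->
  (\sum_(r < N) part mu r = size (skew mu la) + \sum_(r < N) part la r)%N.
Proof.
move=> sub muN; have laN : (size (val la) <= N)%N.
  apply: leq_trans muN; rewrite leqNgt -part_gt0 -leqNgt.
  by apply: leq_trans (sub _) _; rewrite leqNgt part_gt0 ltnn.
rewrite -!size_diagram // addnC -(count_predC (mem (diagram la))) -!size_filter.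
congr (_ + _)%N; apply/perm_size/uniq_perm; rewrite ?filter_uniq ?diagram_uniq //.
move=> x; rewrite mem_filter /=; case: (boolP (x \in diagram la)) => //= xla.
by apply: (proj2 (subset_diagramP la mu)).
Qed.

(** * Connectedness, and ribbons described row by row *)

Definition linked (s : seq box) (b b' : box) : Prop :=
  exists p : seq box, [/\ path adjacent b p, {subset p <= s} & last b p = b'].

Lemma adjacent_sym : symmetric adjacent.
Proof. by move=> [a b] [c d]; rewrite /adjacent /=; lia. Qed.

Lemma linked_refl s b : linked s b b.
Proof. by exists [::]. Qed.

Lemma linked_trans s b c d : linked s b c -> linked s c d -> linked s b d.
Proof.
move=> [p [pp ps pl]] [p' [pp' ps' pl']]; exists (p ++ p'); split.
- by rewrite cat_path pp pl.
- by move=> x; rewrite mem_cat => /orP[/ps|/ps'].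
- by rewrite last_cat pl.
Qed.

Lemma linked_sym s b c : b \in s -> linked s b c -> linked s c b.
Proof.
move=> bs [p [pp ps <-]]; exists (rev (belast b p)); split.
- by rewrite rev_path (eq_path (e' := adjacent)) // => x y; exact: adjacent_sym.
- move=> x; rewrite mem_rev => /mem_belast; rewrite inE => /orP[/eqP -> //|].
  exact: ps.
- by case: p {pp ps} => [//|a p] /=; rewrite rev_cons last_rcons.
Qed.

Lemma linked1 s b c : c \in s -> adjacent b c -> linked s b c.
Proof.
move=> cs bc; exists [:: c]; split=> //=; first by rewrite bc.
by move=> x; rewrite inE => /eqP ->.
Qed.

(** A step changes the row by at most one, so the step on which the path first leaves the rows up to
    [k] is vertical: it goes from row [k] to row [k.+1] within one column. *)
Lemma path_crosses_row (s p : seq box) (x : box) (k : nat) :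
  path adjacent x p -> {subset p <= s} -> x \in s ->
  (x.1 <= k)%N -> (k < (last x p).1)%N ->
  exists c, (k, c) \in s /\ (k.+1, c) \in s.
Proof.
elim: p x => [|y p IH] x /=; first by move=> _ _ _ ? ?; lia.
move=> /andP[xy pp] ps xs xk kl.
have ys : y \in s by apply: ps; rewrite mem_head.
have ps' : {subset p <= s} by move=> z zp; apply: ps; rewrite inE zp orbT.
have [yk|yk] := leqP y.1 k; first exact: (IH y pp ps' ys yk kl).
exists x.2; move: xy yk; clear IH pp kl ps ps'.
case: x xs xk => x1 x2 xs /= xk; case: y ys => y1 y2 ys.
rewrite /adjacent /= => xy yk.
have [ek e2 e1] : [/\ k = x1, y2 = x2 & y1 = x1.+1] by split; lia.
by rewrite ek -{2}e2 -e1.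
Qed.

(* [mu / la] is a ribbon occupying exactly the rows [t], ..., [b]; each row
   below the top one overlaps the row above it in a single column. *)
Definition strip (la mu : intpart) (t b : nat) : Prop :=
  [/\ (t <= b)%N, (part la t < part mu t)%N,
      forall k, (k < t)%N || (b < k)%N -> part mu k = part la k
    & forall k, (t <= k < b)%N -> part mu k.+1 = (part la k).+1].

Section Strip.
Variables (la mu : intpart) (t b : nat).
Hypothesis st : strip la mu t b.

Lemma strip_lt k : (t <= k <= b)%N -> (part la k < part mu k)%N.
Proof.
case: st => tb lt_t _ hk /andP[tk kb].
have [e|tk'] := eqVneq t k; first by rewrite -e.
have e : k = k.-1.+1 by lia.
have {e} -> : part mu k = (part la k.-1).+1 by rewrite [in LHS]e hk //; lia.
by rewrite ltnS; apply: part_homo; exact: leq_pred.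
Qed.

Lemma strip_out k : ~~ (t <= k <= b)%N -> part mu k = part la k.
Proof. by case: st => _ _ h _ kP; apply: h; lia. Qed.

Lemma strip_le k : (part la k <= part mu k)%N.
Proof.
by have [/strip_lt/ltnW //|/strip_out -> //] := boolP (t <= k <= b)%N.
Qed.

(** Row [k.+1] of [mu] is one longer than row [k] of [la], so the differences of row lengths
    telescope and only the two end rows remain. *)
Lemma strip_size : (size (skew mu la) + part la b = part mu t + (b - t))%N.
Proof.
case: st => tb lt_t out hk.
pose N := (size (val mu) + b.+1)%N.
have tele k : (t <= k <= b)%N ->
    (\sum_(0 <= r < k.+1) part mu r + part la k =
     \sum_(0 <= r < k.+1) part la r + part mu t + (k - t))%N.
  elim: k => [|k IH] /andP[tk kb].
    have -> : t = 0%N by lia.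
    rewrite !big_nat1; lia.
  have [e|tk'] := eqVneq t k.+1.
    rewrite -e !big_nat_recr //=.
    have -> : (\sum_(0 <= r < t) part mu r = \sum_(0 <= r < t) part la r)%N.
      by rewrite !big_nat; apply: eq_bigr => r /andP[_ rt]; rewrite out ?rt.
    lia.
  have {}IH := IH ltac:(lia).
  rewrite big_nat_recr // [in RHS]big_nat_recr //= hk; lia.
have h := size_skew strip_le (leq_addr b.+1 (size (val mu)) : (_ <= N)%N).
have bN : (b.+1 <= N)%N by exact: leq_addl.
rewrite -!(big_mkord xpredT) !(big_cat_nat (leq0n _) bN) //= in h.
have e : (\sum_(b.+1 <= r < N) part mu r = \sum_(b.+1 <= r < N) part la r)%N.
  by rewrite !big_nat; apply: eq_bigr => r /andP[br _]; rewrite out // br orbT.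
have := tele b; rewrite tb leqnn => /(_ isT); lia.
Qed.

Lemma strip_spin : spin (skew mu la) = (b - t)%N.
Proof.
rewrite /spin; suff /perm_size -> :
    perm_eq (undup [seq x.1 | x <- skew mu la]) (iota t (b - t).+1).
  by rewrite size_iota.
apply: uniq_perm; rewrite ?undup_uniq ?iota_uniq // => r.
have [tb _ _ _] := st.
rewrite mem_undup mem_iota; apply/mapP/idP => [[[r' c] + /= ->]|rP].
  rewrite mem_skew => h; have := @strip_out r'; lia.
exists (r, part la r) => //; rewrite mem_skew leqnn strip_lt //; lia.
Qed.

Lemma strip_connected : box_connected (skew mu la).
Proof.
have [tb lt_t _ hk] := st.
pose s := skew mu la.
(* Each box is linked to the left end of its row; [top] then links these left ends, passing from row
   [k] to the box just below its left end. *)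
have row k c : (k, c) \in s -> linked s (k, part la k) (k, c).
  rewrite /s mem_skew; elim: c => [|c IH] kc.
    have -> : part la k = 0%N by lia.
    exact: linked_refl.
  have [e|cP] := eqVneq (part la k) c.+1; first by rewrite e; exact: linked_refl.
  apply: (@linked_trans _ _ (k, c)); first by apply: IH; lia.
  by apply: linked1; rewrite ?mem_skew // /adjacent /= !eqxx.
have inS k : (t <= k <= b)%N -> (k, part la k) \in s.
  by move=> kP; rewrite /s mem_skew leqnn strip_lt.
have top k : (t <= k <= b)%N -> linked s (t, part la t) (k, part la k).
  elim: k => [|k IH] /andP[tk kb].
    have -> : t = 0%N by lia.
    exact: linked_refl.
  have [->|tk'] := eqVneq t k.+1; first exact: linked_refl.
  have mem1 : (k.+1, part la k) \in s.
    by rewrite /s mem_skew part_homo //= hk //; lia.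
  apply: (@linked_trans _ _ (k, part la k)); first by apply: IH; lia.
  apply: (@linked_trans _ _ (k.+1, part la k)).
    by apply: linked1 => //; rewrite /adjacent /= !eqxx /= orbT.
  by apply: linked_sym (row _ _ mem1); apply: inS; lia.
have any x : x \in s -> linked s (t, part la t) x.
  case: x => k c kc; apply: linked_trans (row _ _ kc); apply: top.
  by apply: contraTT kc => /strip_out e; rewrite /s mem_skew e; lia.
move=> x y xs ys; apply: linked_trans (any _ ys).
by apply: linked_sym (any _ xs); apply: inS; rewrite leqnn.
Qed.

Lemma strip_no_square : no_square (skew mu la).
Proof.
move=> r c sub.
have /sub : (r, c) \in [:: (r, c); (r, c.+1); (r.+1, c); (r.+1, c.+1)].
  by rewrite !inE eqxx.
have /sub : (r.+1, c.+1) \in [:: (r, c); (r, c.+1); (r.+1, c); (r.+1, c.+1)].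
  by rewrite !inE eqxx !orbT.
rewrite !mem_skew => h1 h2.
have := @strip_out r.+1; have := @strip_out r.
have [_ _ _ /(_ r)] := st; lia.
Qed.

Lemma strip_head : is_head (t, (part mu t).-1) (skew mu la).
Proof.
have [tb lt_t _ _] := st.
split; first by rewrite mem_skew; lia.
move=> [r c]; rewrite mem_skew /= => rc.
have tr : (t <= r)%N by have := @strip_out r; lia.
have := part_homo mu tr; lia.
Qed.

Lemma strip_adds_ribbon (n : nat) (i : int) :
  (part mu t)%:Z - t%:Z = i + 1 -> (part la b)%:Z - b%:Z = i + 1 - n%:Z ->
  adds_ribbon n i la mu.
Proof.
move=> et eb; have := strip_size; have [tb lt_t _ _] := st => sz.
split; last first.
  exists (t, (part mu t).-1); first exact: strip_head.
  rewrite /diagonal /=; lia.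
split; [exact/subset_diagramP/strip_le | lia | exact: strip_connected |
  exact: strip_no_square].
Qed.

End Strip.

(** The head gives the top row [t], and [b] is the last row in which the diagrams differ.
    Connectedness makes consecutive rows share a column, and the absence of squares forbids a second
    one. *)
Lemma adds_ribbon_strip (n : nat) (i : int) (la mu : intpart) :
  adds_ribbon n i la mu ->
  exists t b, [/\ strip la mu t b, (part mu t)%:Z - t%:Z = i + 1
    & (part la b)%:Z - b%:Z = i + 1 - n%:Z].
Proof.
move=> [[/subset_diagramP sub sz conn nosq] [[t c] [hs hmax] <-]].
rewrite mem_skew in hs.
have ec : c = (part mu t).-1.
  have /hmax : (t, (part mu t).-1) \in skew mu la by rewrite mem_skew; lia.
  rewrite /=; lia.
have exP : exists k, (part la k < part mu k)%N by exists t; lia.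
have bnd k : (part la k < part mu k)%N -> (k <= size (val mu))%N.
  by move=> h; apply: ltnW; rewrite -part_gt0; lia.
case: (ex_maxnP exP bnd) => b bP bmax.
have tb : (t <= b)%N by apply: bmax; lia.
suff st : strip la mu t b.
  exists t, b; have := strip_size st; split=> //; rewrite /diagonal /=; lia.
split=> // [|k /orP[kt|bk]|k /andP[tk kb]]; first lia.
- apply/eqP; rewrite eqn_leq sub andbT leqNgt; apply: contraL kt => kP.
  have /hmax[] : (k, part la k) \in skew mu la by rewrite mem_skew leqnn.
  by rewrite -leqNgt.
- apply/eqP; rewrite eqn_leq sub andbT leqNgt; apply: contraL bk => /bmax.
  by rewrite -leqNgt.
have ts : (t, c) \in skew mu la by rewrite mem_skew.
have bs : (b, part la b) \in skew mu la by rewrite mem_skew leqnn.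
have [p [pp ps pl]] := conn _ _ ts bs.
have [] := path_crosses_row pp ps ts tk; first by rewrite pl.
move=> d; rewrite !mem_skew => -[d1 d2].
apply/eqP; rewrite eqn_leq; apply/andP; split; last lia.
rewrite leqNgt; apply/negP => big; apply: (nosq k (part la k)) => x.
have := part_homo mu (leqnSn k); have := part_homo la (leqnSn k) => h1 h2.
rewrite !inE => /or4P[] /eqP ->; rewrite mem_skew; lia.
Qed.

(** * Beads of a partition *)

Definition bead (la : intpart) (x : int) : bool :=
  `[< exists r : nat, x = (part la r)%:Z - r%:Z >].

Lemma beadP la x : reflect (exists r : nat, x = (part la r)%:Z - r%:Z) (bead la x).
Proof. exact: asboolP. Qed.

(** Beads strictly decrease from row to row. In the first row where the parts differ, the larger
    bead cannot occur in the other partition: earlier rows agree and have larger beads, later rows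
    have smaller ones. *)
Lemma eq_bead (la mu : intpart) : bead la =1 bead mu -> la = mu.
Proof.
move=> e; apply: eq_part; elim/ltn_ind => r IH.
wlog le : la mu e IH / (part la r <= part mu r)%N.
  move=> w; have [/w|/ltnW/w] := leqP (part la r) (part mu r); first exact.
  by move=> h; apply/esym/h => [x|k /IH] //; rewrite e.
apply/eqP; rewrite eqn_leq le leqNgt; apply/negP => lt.
have /beadP[k ek] : bead la ((part mu r)%:Z - r%:Z) by rewrite e; apply/beadP; exists r.
have [kr|rk] := ltnP k r; last by have := part_homo la rk; lia.
have := IH k kr; have := part_homo mu (ltnW kr); lia.
Qed.

(** The number of beads jumped over when a bead moves from [v] to [v + n]; it becomes the spin in
    [strip_bcount]. *)
Definition bcount (n : nat) (la : intpart) (v : int) : nat :=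
  count (bead la) [seq v + k%:Z | k <- iota 1 n.-1].

Lemma mem_between n v x :
  (x \in [seq v + k%:Z | k <- iota 1 n.-1]) = (v < x < v + n%:Z).
Proof.
apply/mapP/idP => [[k]|h]; first by rewrite mem_iota => ? ->; lia.
by exists `|x - v|%N; [rewrite mem_iota; lia | lia].
Qed.

Lemma uniq_between n (v : int) : uniq [seq v + k%:Z | k <- iota 1 n.-1].
Proof. by rewrite map_inj_uniq ?iota_uniq // => x y; lia. Qed.

Section StripBeads.
Variables (n : nat) (la mu : intpart) (t b : nat) (v : int).
Hypothesis st : strip la mu t b.
Hypothesis ev : (part la b)%:Z - b%:Z = v.
Hypothesis evn : (part mu t)%:Z - t%:Z = v + n%:Z.

(** In rows [t.+1] to [b] the bead of [mu] is the bead of [la] one row higher. Hence only the bead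
    of row [b] of [la] is lost, and only the one of row [t] of [mu] is new. *)
Lemma strip_bead x : bead mu x = (bead la x && (x != v)) || (x == v + n%:Z).
Proof.
have [tb lt_t out hk] := st.
apply/beadP/idP => [[r ->]|/orP[/andP[/beadP[r ->] rv]|/eqP ->]]; last by exists t.
- have [rout|rin] := boolP ((r < t) || (b < r))%N.
    apply/orP; left; rewrite out //; apply/andP; split; first by apply/beadP; exists r.
    have [rb|br] := leqP r b; first by have := part_homo la rb; lia.
    by have := part_homo la (ltnW br); lia.
  have [->|tr] := eqVneq r t; first by rewrite evn eqxx orbT.
  have er : r = r.-1.+1 by lia.
  have hm : part mu r = (part la r.-1).+1 by rewrite [in LHS]er hk //; lia.
  apply/orP; left; apply/andP; split; first by apply/beadP; exists r.-1; lia.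
  have rb : (r.-1 <= b)%N by lia.
  by have := part_homo la rb; lia.
- have rb : r != b by apply: contra_neq rv => ->.
  have [rout|rin] := boolP ((r < t) || (b < r))%N; first by exists r; rewrite out.
  by exists r.+1; rewrite hk; lia.
Qed.

Lemma strip_bead_top : ~~ bead la (v + n%:Z).
Proof.
have [tb lt_t out hk] := st; apply/beadP => -[r er].
have [tr|rt] := leqP t r; first by have := part_homo la tr; lia.
by have := out r; rewrite rt => /(_ isT); have := part_homo mu (ltnW rt); lia.
Qed.

Lemma strip_bcount : bcount n la v = (b - t)%N.
Proof.
have [tb lt_t out hk] := st.
rewrite /bcount -size_filter.
suff /perm_size -> : perm_eq [seq x <- [seq v + k%:Z | k <- iota 1 n.-1] | bead la x]
    [seq (part la k)%:Z - k%:Z | k <- iota t (b - t)].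
  by rewrite size_map size_iota.
apply: uniq_perm; first by rewrite filter_uniq // uniq_between.
  rewrite map_inj_uniq ?iota_uniq // => x y.
  have [xy|yx] := leqP x y; first by have := part_homo la xy; lia.
  by have := part_homo la (ltnW yx); lia.
move=> x; rewrite mem_filter mem_between.
apply/andP/mapP => [[/beadP[r ->] h]|[r + ->]].
  exists r => //; rewrite mem_iota.
  have rb : (r < b)%N.
    by rewrite ltnNge; apply/negP => br; have := part_homo la br; lia.
  have tr : (t <= r)%N.
    rewrite leqNgt; apply/negP => rt; have := out r; rewrite rt => /(_ isT).
    by have := part_homo mu (ltnW rt); lia.
  lia.
rewrite mem_iota => rP; split; first by apply/beadP; exists r.
have rb : (r <= b)%N by lia.
have tr : (t <= r)%N by lia.
by have := part_homo la rb; have := part_homo la tr; lia.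
Qed.

End StripBeads.

(** The new bead is inserted into the decreasing sequence of beads: [t] is the first row whose bead
    lies below it, and the beads of the rows from [t] up to, but excluding, [b] slide down one
    row. *)
Lemma strip_exists (n : nat) (la : intpart) (v : int) : (0 < n)%N ->
  bead la v -> ~~ bead la (v + n%:Z) ->
  exists mu t b, [/\ strip la mu t b, (part la b)%:Z - b%:Z = v
    & (part mu t)%:Z - t%:Z = v + n%:Z].
Proof.
move=> n0 /beadP[b eb] nb.
have nb' r : (part la r)%:Z - r%:Z != v + n%:Z.
  by apply: contraNneq nb => <-; apply/beadP; exists r.
have ext : exists t, ((part la t)%:Z - t%:Z < v + n%:Z) by exists b; lia.
case: (ex_minnP ext) => t tP tmin.
have tb : (t <= b)%N by apply: tmin; lia.
have above r : (r < t)%N -> v + n%:Z < (part la r)%:Z - r%:Z.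
  by move=> rt; have := nb' r; have := tmin r; lia.
(* The bead of row [t] is at least [- t] and lies below [v + n], so [absz] in [f] does not alter the
   intended row length. *)
have vt0 : 0 <= v + n%:Z + t%:Z by lia.
pose f (k : nat) := if k == t then absz (v + n%:Z + t%:Z)
  else if (t < k <= b)%N then (part la k.-1).+1 else part la k.
have fh i j : (i <= j)%N -> (f j <= f i)%N.
  move=> ij; have lij := part_homo la ij; have lb := part_homo la tb.
  have lij' : (i.-1 <= j.-1)%N by lia.
  have lij2 := part_homo la lij'.
  have li := part_homo la (leq_pred i); have lj := part_homo la (leq_pred j).
  have ai : (i < t -> part la t.-1 <= part la i)%N.
    by move=> it; apply: part_homo; lia.
  have at1 : (0 < t)%N -> v + n%:Z < (part la t.-1)%:Z - t.-1%:Z.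
    by move=> t0; apply: above; lia.
  have jt : (t < j -> part la j.-1 <= part la t)%N.
    by move=> tj; apply: part_homo; lia.
  have jt' : (t < j -> part la j <= part la t)%N.
    by move=> tj; apply: part_homo; lia.
  have ji : (i < j -> part la j.-1 <= part la i)%N.
    by move=> h; apply: part_homo; lia.
  have tj : (t <= j -> part la j <= part la t)%N by apply: part_homo.
  rewrite /f; case: (eqVneq j t) => [jE|jt0]; case: (eqVneq i t) => [iE|it0] //.
  - case: ifP => h; lia.
  - case: ifP => h; lia.
  - case: ifP => h; case: ifP => h'; lia.
have fz : exists k, f k == 0%N.
  exists (size (val la) + b).+1; rewrite /f.
  have -> : ((size (val la) + b).+1 == t) = false by lia.
  have -> : (t < (size (val la) + b).+1 <= b)%N = false by lia.
  by rewrite /part nth_default //; lia.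
have [mu emu] := intpart_of fh fz.
exists mu, t, b; split => //; last by rewrite emu /f eqxx; lia.
split=> // [|k kP|k kP].
- by rewrite emu /f eqxx; lia.
- rewrite emu /f; have -> : (k == t) = false by lia.
  by have -> : (t < k <= b)%N = false by lia.
- rewrite emu /f; have -> : (k.+1 == t) = false by lia.
  by have -> : (t < k.+1 <= b)%N by lia.
Qed.

Section BeadMove.
Variables (K : fieldType) (q : K) (n : nat).
Hypothesis n0 : (0 < n)%N.

(** Every [mu] obtained by adding the ribbon has the stated spin and beads, so nothing has to be
    known about the choice made in [u_basis]. *)
Lemma u_basis_move (v : int) (la : intpart) :
  bead la v -> ~~ bead la (v + n%:Z) ->
  exists mu, u_basis q n (v + n%:Z - 1) la = << q ^+ bcount n la v *g mu >>
  /\ forall x, bead mu x = (bead la x && (x != v)) || (x == v + n%:Z).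
Proof.
move=> bv bvn; rewrite /u_basis; case: pselect => [h|[]]; last first.
  have [mu [t [b [st eb et]]]] := strip_exists n0 bv bvn.
  by exists mu; apply: (strip_adds_ribbon st); rewrite ?et ?eb; lia.
case: (cid h) => mu /= /adds_ribbon_strip[t [b [st et eb]]].
have eb' : (part la b)%:Z - b%:Z = v by lia.
have et' : (part mu t)%:Z - t%:Z = v + n%:Z by lia.
exists mu; rewrite (strip_spin st) (strip_bcount st eb' et').
by split=> // x; rewrite (strip_bead st eb' et').
Qed.

Lemma u_basis_stuck (v : int) (la : intpart) :
  ~~ (bead la v && ~~ bead la (v + n%:Z)) -> u_basis q n (v + n%:Z - 1) la = 0.
Proof.
move=> nb; rewrite /u_basis; case: pselect => // h.
have [mu /adds_ribbon_strip[t [b [st et eb]]]] := h.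
have eb' : (part la b)%:Z - b%:Z = v by lia.
have et' : (part mu t)%:Z - t%:Z = v + n%:Z by lia.
case/negP: nb; rewrite (strip_bead_top st eb' et') andbT.
by apply/beadP; exists b.
Qed.

End BeadMove.

(** * The identity over a finite alphabet *)

(** Strictly decreasing words in the letters below [m], generated by their first and largest letter;
    the induction on the length of the first row removes exactly this letter. *)
Fixpoint dwords (k m : nat) : seq (seq nat) :=
  if k is k'.+1 then
    flatten [seq [seq a :: w | w <- dwords k' a] | a <- iota 0 m]
  else [:: [::]].

Lemma big_dwordsS (V : nmodType) (F : seq nat -> V) (k m : nat) :
  \sum_(w <- dwords k.+1 m) F w =
  \sum_(a < m) \sum_(w <- dwords k a) F ((a : nat) :: w).
Proof.
rewrite /= big_flatten big_map -(big_mkord xpredT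
  (fun a => \sum_(w <- dwords k a) F (a :: w))) /index_iota subn0.
by apply: eq_bigr => a _; rewrite big_map.
Qed.

Lemma big_dwords1 (V : nmodType) (F : seq nat -> V) (m : nat) :
  \sum_(w <- dwords 1 m) F w = \sum_(a < m) F [:: a : nat].
Proof.
by rewrite big_dwordsS; apply: eq_bigr => a _; rewrite /= big_seq1.
Qed.

Lemma big_dwords2 (V : nmodType) (F : seq nat -> V) (m : nat) :
  \sum_(w <- dwords 2 m) F w = \sum_(a < m) \sum_(b < a) F [:: a : nat; b : nat].
Proof.
by rewrite big_dwordsS; apply: eq_bigr => a _; rewrite big_dwords1.
Qed.

Lemma mem_dwords (k m : nat) (w : seq nat) :
  (w \in dwords k m) =
  [&& size w == k, sorted gtn w & all (fun i => (i < m)%N) w].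
Proof.
elim: k m w => [|k IH] m [|a w] //=.
  by apply/flattenP => -[_ /mapP[a _ ->]] /mapP[].
have -> : (path gtn a w = all (fun i => (i < a)%N) w && sorted gtn w).
  by rewrite path_sortedE // => x y z; rewrite /=; lia.
apply/flattenP/idP => [[_ /mapP[b] + ->] /mapP[w' +] [-> ->]|].
  rewrite mem_iota IH eqSS => /andP[_ bm] /and3P[-> -> al]; rewrite al /=.
  rewrite add0n in bm; rewrite bm /=.
  by apply: sub_all al => i ib; exact: ltn_trans bm.
rewrite eqSS => /and4P[sw /andP[al so] am _].
exists [seq a :: w | w <- dwords k a].
  by apply/mapP; exists a; rewrite // mem_iota.
by apply/mapP; exists w; rewrite // IH sw so.
Qed.

Lemma dwords_uniq (k m : nat) : uniq (dwords k m).
Proof.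
elim: k m => [//|k IH] m; apply: allpairs_uniq_dep; rewrite ?iota_uniq //.
by move=> [a w] [b w'] /= _ _ [-> ->].
Qed.

(* Condition (3) and [T(1,2) <= T(2,2)] for the entries [a1 = T(1,1)],
   [a2 = T(1,2)], [b1 = T(2,1)], [b2 = T(2,2)]. *)
Definition ncb (n a1 a2 b1 b2 : nat) : bool :=
  (a2 <= b2)%N &&
  ((b1 < a1)%N && (b2 <= b1 + n)%N
   || (a1 < b1)%N && ((a2 <= b1)%N || (b1 < a2)%N && (a1 + n < b2)%N)).

(* Words are stored with the largest letter first, so the first column of a
   tableau is read off from the end. *)
Definition ncw (n : nat) (w w' : seq nat) : bool :=
  ncb n (nth 0%N (rev w) 0) (nth 0%N (rev w) 1)
        (nth 0%N (rev w') 0) (nth 0%N (rev w') 1).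

(** * Sums over triples of letters *)

Section TripleSums.
Variables (V : nmodType) (M : nat).
Implicit Types (P Q : nat -> nat -> nat -> bool) (G : nat -> nat -> nat -> V).

(** All indices run over one common range and all constraints sit in the predicate. Splitting a sum
    or permuting its indices then leaves only linear arithmetic on predicates. *)
Definition sum3 P G : V :=
  \sum_(p : 'I_M * 'I_M * 'I_M | P p.1.1 p.1.2 p.2) G p.1.1 p.1.2 p.2.

Lemma sum3E P G :
  sum3 P G = \sum_(i < M) \sum_(j < M) \sum_(k < M | P i j k) G i j k.
Proof.
rewrite /sum3 pair_big /= pair_big_dep /=.
by apply: eq_bigl => -[[i j] k].
Qed.

Lemma sum3ID Q P G :
  sum3 P G = sum3 (fun i j k => P i j k && Q i j k) G
           + sum3 (fun i j k => P i j k && ~~ Q i j k) G.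
Proof. by rewrite /sum3 (bigID (fun p : 'I_M * 'I_M * 'I_M => Q p.1.1 p.1.2 p.2)). Qed.

Lemma sum3D P G G' :
  sum3 P (fun i j k => G i j k + G' i j k) = sum3 P G + sum3 P G'.
Proof. exact: big_split. Qed.

Lemma eq_sum3l P Q G :
  (forall i j k, (i < M -> j < M -> k < M -> P i j k = Q i j k)%N) ->
  sum3 P G = sum3 Q G.
Proof. by move=> e; apply: eq_bigl => -[[i j] k] /=; rewrite e. Qed.

Lemma eq_sum3r P G G' : (forall i j k, P i j k -> G i j k = G' i j k) ->
  sum3 P G = sum3 P G'.
Proof. by move=> e; apply: eq_bigr => -[[i j] k] /e. Qed.

Lemma sum3_0 P G : (forall i j k, P i j k -> G i j k = 0) -> sum3 P G = 0.
Proof. by move=> e; apply: big1 => -[[i j] k] /e. Qed.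

Lemma sum3_swapl P G :
  sum3 P G = sum3 (fun i j k => P j i k) (fun i j k => G j i k).
Proof.
rewrite /sum3 (reindex (fun p : 'I_M * 'I_M * 'I_M => (p.1.2, p.1.1, p.2))) //.
by exists (fun p => (p.1.2, p.1.1, p.2)) => -[[i j] k].
Qed.

Lemma sum3_swapr P G :
  sum3 P G = sum3 (fun i j k => P i k j) (fun i j k => G i k j).
Proof.
rewrite /sum3 (reindex (fun p : 'I_M * 'I_M * 'I_M => (p.1.1, p.2, p.1.2))) //.
by exists (fun p => (p.1.1, p.2, p.1.2)) => -[[i j] k].
Qed.

Lemma sum3_bigE (a : nat) G : (a <= M)%N ->
  \sum_(i < a) \sum_(j < i) \sum_(k < M) G i j k =
  sum3 (fun i j _ => (j < i < a)%N) G.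
Proof.
move=> aM; rewrite sum3E.
rewrite (big_ord_widen M (fun i => \sum_(j < i) \sum_(k < M) G i j k) aM).
rewrite big_mkcond; apply: eq_bigr => i _; case: ifP => ia; last first.
  by rewrite big1 // => j _; rewrite big_pred0 // => k /=; rewrite andbF.
rewrite (big_ord_widen M (fun j => \sum_(k < M) G i j k) (ltnW (ltn_ord i))).
rewrite big_mkcond; apply: eq_bigr => j _.
by rewrite andbT; case: ifP => // _; rewrite big_pred0.
Qed.

Lemma sum3_bigE_cond (a : nat) (P : nat -> nat -> nat -> bool) G : (a <= M)%N ->
  \sum_(i < a) \sum_(j < M) \sum_(k < j | P i j k) G i j k =
  sum3 (fun i j k => (i < a)%N && (k < j)%N && P i j k) G.
Proof.
move=> aM; rewrite sum3E.
rewrite (big_ord_widen M (fun i => \sum_(j < M) \sum_(k < j | P i j k) G i j k) aM).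
rewrite big_mkcond; apply: eq_bigr => i _; case: ifP => ia; last first.
  by rewrite big1 // => j _; rewrite big_pred0.
apply: eq_bigr => j _.
rewrite (big_ord_widen_cond M (fun k => P i j k) (fun k => G i j k)
  (ltnW (ltn_ord j))).
by apply: eq_bigl => k; rewrite andbC.
Qed.

End TripleSums.

Section FiniteAlphabet.
Variables (A : pzRingType) (n : nat) (u : nat -> A).
Hypothesis usq : forall i, u i * u i = 0.
Hypothesis usand : forall i j, u i * u j * u i = 0.
Hypothesis ufar : forall i j, (i + n < j)%N -> u i * u j = u j * u i.
Hypothesis uxzy : forall x y z, (x < y < z)%N -> (z <= x + n)%N ->
  u x * u z * u y = u y * u x * u z.
Hypothesis uyzx : forall x y z, (x < y < z)%N -> (z <= x + n)%N ->
  u y * u z * u x = u z * u x * u y.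

Definition uw (w : seq nat) : A := \prod_(i <- w) u i.

Definition hfin (k m : nat) : A := \sum_(w <- dwords k m) uw w.

(** The bound [m] restricts the first row only: it shrinks as the largest letters of that row are
    removed, while the second row keeps the alphabet [M]. *)
Definition ncfin (s m M : nat) : A :=
  \sum_(w <- dwords s m) \sum_(w' <- dwords 2 M | ncw n w w') uw w * uw w'.

Let F i j k := u i * u j * u k.

(** This is $h_1 h_2 = h_2 h_1$ over the letters below [a]. Words with a repeated letter vanish. For
    $x<y<z$ both sides contain the word $zyx$; what remains is $xzy + yzx = zxy + yxz$, which
    follows from [uxzy] and [uyzx] if $z \le x+n$, and from the commutation of $u_x$ and $u_z$
    otherwise. *)
Lemma hfin12_comm M a :
  sum3 M (fun i j k => (i < a) && (k < j < a))%N F =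
  sum3 M (fun x y b => (y < x < a) && (b < a))%N F.
Proof.
pose D x y z := (x < y < z)%N && (z < a)%N.
have usq3 i k : F i i k = 0 by rewrite /F usq mul0r.
have usq3' i k : F k i i = 0 by rewrite /F -mulrA usq mulr0.
rewrite (sum3ID _ (fun i j k => (i == k) || (i == j))) sum3_0 ?add0r; last first.
  by move=> i j k /andP[_ /orP[] /eqP ->]; [exact: usand | exact: usq3].
(* The letter [i] now lies below, between or above [k < j], which gives the three arrangements on
   the left. *)
rewrite (sum3ID _ (fun i j k => (i < k)%N)).
rewrite (sum3ID _ (fun i j k => (i < j)%N) (fun i j k => _ && ~~ (i < k)%N)).
rewrite [RHS](sum3ID _ (fun x y b => (b == x) || (b == y))).
rewrite [X in _ = X + _]sum3_0 ?add0r; last first.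
  by move=> i j k /andP[_ /orP[] /eqP ->]; [exact: usand | exact: usq3'].
rewrite [RHS](sum3ID _ (fun x y b => (b < y)%N)).
rewrite [X in _ = _ + X](sum3ID _ (fun x y b => (b < x)%N)).
have -> : sum3 M (fun i j k => (((i < a) && (k < j < a)) &&
      ~~ ((i == k) || (i == j))) && (i < k))%N F =
    sum3 M D (fun x y z => F x z y).
  by rewrite sum3_swapr; apply: eq_sum3l => *; rewrite /D; lia.
have -> : sum3 M (fun i j k => ((((i < a) && (k < j < a)) &&
      ~~ ((i == k) || (i == j))) && ~~ (i < k)) && (i < j))%N F =
    sum3 M D (fun x y z => F y z x).
  rewrite sum3_swapr sum3_swapl; apply: eq_sum3l => *; rewrite /D; lia.
have -> : sum3 M (fun i j k => ((((i < a) && (k < j < a)) &&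
      ~~ ((i == k) || (i == j))) && ~~ (i < k)) && ~~ (i < j))%N F =
    sum3 M D (fun x y z => F z y x).
  by rewrite sum3_swapr sum3_swapl sum3_swapr; apply: eq_sum3l => *; rewrite /D; lia.
have -> : sum3 M (fun x y b => (((y < x < a) && (b < a)) &&
      ~~ ((b == x) || (b == y))) && (b < y))%N F =
    sum3 M D (fun x y z => F z y x).
  by rewrite sum3_swapr sum3_swapl sum3_swapr; apply: eq_sum3l => *; rewrite /D; lia.
have -> : sum3 M (fun x y b => ((((y < x < a) && (b < a)) &&
      ~~ ((b == x) || (b == y))) && ~~ (b < y)) && (b < x))%N F =
    sum3 M D (fun x y z => F z x y).
  by rewrite sum3_swapl sum3_swapr; apply: eq_sum3l => *; rewrite /D; lia.
have -> : sum3 M (fun x y b => ((((y < x < a) && (b < a)) &&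
      ~~ ((b == x) || (b == y))) && ~~ (b < y)) && ~~ (b < x))%N F =
    sum3 M D (fun x y z => F y x z).
  by rewrite sum3_swapl; apply: eq_sum3l => *; rewrite /D; lia.
rewrite addrA [RHS]addrC; congr (_ + _).
rewrite -!sum3D; apply: eq_sum3r => x y z /andP[xyz _]; rewrite /F.
have [zx|xz] := leqP z (x + n).
  by rewrite (uxzy xyz zx) (uyzx xyz zx) addrC.
by rewrite (ufar xz) -!mulrA (ufar xz).
Qed.

(* Fillings that are not n-commuting are matched with the words of
   [h_(s+1) h_1]: those with [T(1,2) > T(2,2)] because [h_1 h_2 = h_2 h_1] for
   the letters below [T(1,2)], the others one by one. *)
Lemma ncfin_base M a : (a <= M)%N ->
  sum3 M (fun i j k => (i < a) && (k < j))%N F =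
  sum3 M (fun i j k => [&& i < a, k < j & ncb n i a k j])%N F
  + sum3 M (fun x y _ => y < x < a)%N F.
Proof.
move=> aM; rewrite (sum3ID _ (fun i j k => ncb n i a k j)).
congr (_ + _); first by apply: eq_sum3l => *; rewrite andbA.
(* The letters are $i = T(1,1)$, $a = T(1,2)$, $k = T(2,1)$, $j = T(2,2)$. For [j < a] no filling is
   n-commuting, and the words with all three of [i], [j], [k] below [a] are exchanged by
   [hfin12_comm]. *)
rewrite (sum3ID _ (fun i j k => j < a)%N).
rewrite [RHS](sum3ID _ (fun i j k => k < a)%N).
congr (_ + _).
  rewrite -[RHS]hfin12_comm; apply: eq_sum3l => *; rewrite /ncb; lia.
rewrite (sum3ID _ (fun i j k => i == k)) sum3_0 ?add0r; last first.
  by move=> i j k /andP[_ /eqP ->]; exact: usand.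
(* With [a <= j], failure of condition (3) means [k + n < j] if [k < i], and [k < a], [j <= i + n]
   if [i < k]. The first case uses [ufar], the second [uxzy]; they produce the words with
   [y + n < b] and with [b <= y + n]. *)
rewrite (sum3ID _ (fun i j k => k < i)%N).
rewrite [RHS](sum3ID _ (fun x y b => y + n < b)%N).
congr (_ + _).
  rewrite sum3_swapr; transitivity (sum3 M (fun x y b =>
      [&& y < x, x < a, a <= b & y + n < b])%N (fun x y b => F x b y)).
    by apply: eq_sum3l => *; rewrite /ncb; lia.
  rewrite (@eq_sum3r _ _ _ _ F) => [|x y b /and4P[_ _ _ yb]].
    by apply: eq_sum3l => *; lia.
  by rewrite /F -!mulrA (ufar yb).
transitivity (sum3 M (fun x y b =>
    [&& y < x, x < a, a <= b & b <= y + n])%N (fun x y b => F y b x)).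
  by rewrite sum3_swapr sum3_swapl; apply: eq_sum3l => *; rewrite /ncb; lia.
rewrite (@eq_sum3r _ _ _ _ F) => [|x y b /and4P[yx xa ab byn]].
  by apply: eq_sum3l => *; lia.
by apply: uxzy => //; rewrite yx; exact: leq_trans ab.
Qed.

Lemma hfinS k m : hfin k.+1 m = \sum_(a < m) u a * hfin k a.
Proof.
rewrite /hfin big_dwordsS; apply: eq_bigr => a _.
by rewrite mulr_sumr; apply: eq_bigr => w _; rewrite /uw big_cons.
Qed.

(** As at least two letters remain, removing the largest one changes neither of the first two
    entries of the first row, the only ones seen by [ncw]. *)
Lemma ncfinS s m M : (2 <= s)%N ->
  ncfin s.+1 m M = \sum_(a < m) u a * ncfin s a M.
Proof.
move=> s2; rewrite /ncfin big_dwordsS; apply: eq_bigr => a _.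
rewrite mulr_sumr !big_seq; apply: eq_bigr => w.
rewrite mem_dwords => /and3P[/eqP sw _ _]; rewrite mulr_sumr.
rewrite (eq_bigl (fun w' => ncw n w w')) => [|w']; last first.
  by rewrite /ncw rev_cons !nth_rcons size_rev sw s2 (ltnW s2).
by apply: eq_bigr => w' _; rewrite /uw big_cons mulrA.
Qed.

(** Induction on [s], removing the largest letter of the first row; the case of two letters is
    [ncfin_base] multiplied on the left by that letter. *)
Lemma hfin_ncfin s m M : (2 <= s)%N -> (m <= M)%N ->
  hfin s m * hfin 2 M = ncfin s m M + hfin s.+1 m * hfin 1 M.
Proof.
move=> s2; rewrite -(subnK s2) addn2; move: (s - 2)%N => {s s2} s.
elim: s m => [|s IH] m mM; last first.
  rewrite (ncfinS _ _ (s := s.+2)) // hfinS (hfinS s.+3) !mulr_suml -big_split.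
  apply: eq_bigr => a _ /=; rewrite -!mulrA -mulrDr; congr (_ * _).
  by apply: IH; apply: ltnW; exact: leq_trans mM.
have uw2 i j : uw [:: i; j] = u i * u j by rewrite /uw !big_cons big_nil mulr1.
have uw1 i : uw [:: i] = u i by rewrite /uw !big_cons big_nil mulr1.
rewrite (hfinS 1 m) (hfinS 2 m) !mulr_suml /ncfin big_dwords2 -big_split /=.
apply: eq_bigr => a _; have aM : (a <= M)%N.
  by apply: ltnW; exact: leq_trans mM.
transitivity (u a * sum3 M (fun i j k => (i < a) && (k < j))%N F).
  rewrite -mulrA; congr (_ * _); rewrite {1}/hfin big_dwords1 mulr_suml.
  transitivity (\sum_(i < a) \sum_(j < M) \sum_(k < j | true) F i j k).
    apply: eq_bigr => i _; rewrite uw1 /hfin big_dwords2 mulr_sumr.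
    apply: eq_bigr => j _; rewrite mulr_sumr; apply: eq_bigr => k _.
    by rewrite uw2 mulrA.
  rewrite (sum3_bigE_cond (fun _ _ _ => true) F aM).
  by apply: eq_sum3l => *; rewrite andbT.
rewrite ncfin_base // mulrDr; congr (_ + _).
  transitivity (u a * \sum_(i < a) \sum_(j < M) \sum_(k < j | ncb n i a k j) F i j k).
    congr (_ * _); rewrite (sum3_bigE_cond (fun i j k => ncb n i a k j) F aM).
    by apply: eq_sum3l => *; rewrite andbA.
  rewrite mulr_sumr; apply: eq_bigr => i _; rewrite [in RHS]big_mkcond.
  rewrite big_dwords2 mulr_sumr.
  apply: eq_bigr => j _; rewrite -[in RHS]big_mkcond mulr_sumr.
  apply: eq_bigr => k _.
  by rewrite !uw2 /F !mulrA.
rewrite -mulrA; congr (_ * _); rewrite -sum3_bigE // {1}/hfin big_dwords2 mulr_suml.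
apply: eq_bigr => i _; rewrite mulr_suml; apply: eq_bigr => j _.
rewrite uw2 /hfin big_dwords1 mulr_sumr; apply: eq_bigr => k _.
by rewrite uw1.
Qed.

End FiniteAlphabet.

(** * Relations between the ribbon operators *)

Lemma endo_expand (K : fieldType) (f : endo (fock K)) (x : fock K) :
  f x = \sum_(la <- msupp x) x@_la *: f << la >>.
Proof.
rewrite {1}[x]monalgE raddf_sum; apply: eq_bigr => la _ /=.
rewrite -linearZ; congr (f _); apply/malgP => mu.
by rewrite mcoeffZ !mcoeffU mulr_natr.
Qed.

Lemma endo_ext (K : fieldType) (f g : endo (fock K)) :
  (forall la, f << la >> = g << la >>) -> f = g.
Proof.
move=> e; apply/endoP => x; rewrite !endo_expand.
by apply: eq_bigr => la _; rewrite e.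
Qed.

Section Relations.
Variables (K : fieldType) (q : K) (n : nat).
Hypothesis q0 : q != 0.
Hypothesis n0 : (0 < n)%N.
Implicit Types (a b v w x y z : int).

(* A ribbon whose head is on diagonal [i] has its new bead at [i + 1]. *)
Definition bmove (v : int) : endo (fock K) := u_op q n (v + n%:Z - 1).

Definition moved (v : int) (la mu : intpart) : Prop :=
  forall x, bead mu x = (bead la x && (x != v)) || (x == v + n%:Z).

Lemma bmove_move v la : bead la v -> ~~ bead la (v + n%:Z) ->
  exists mu, bmove v << la >> = q ^+ bcount n la v *: << mu >> /\ moved v la mu.
Proof.
move=> bv bvn; have [mu [e m]] := u_basis_move q n0 bv bvn.
exists mu; split=> //; rewrite /bmove /u_op linextE e.
by apply/malgP => nu; rewrite mcoeffZ !mcoeffU mulr_natr.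
Qed.

Lemma bmove_stuck v la : ~~ (bead la v && ~~ bead la (v + n%:Z)) ->
  bmove v << la >> = 0.
Proof. by move=> h; rewrite /bmove /u_op linextE u_basis_stuck. Qed.

(** The move removes the bead at [v] and adds one at [v + n]; each correction stands on the side
    where no subtraction of natural numbers occurs. *)
Lemma bcount_moved v w la mu : bead la v -> ~~ bead la (v + n%:Z) ->
  moved v la mu ->
  (bcount n mu w + (w < v < w + n%:Z)%R =
   bcount n la w + (w < v + n%:Z < w + n%:Z)%R)%N.
Proof.
move=> bv bvn m; rewrite -!mem_between.
rewrite -!(count_uniq_mem _ (uniq_between n w)) /bcount.
elim: [seq _ | _ <- _] => [//|x s IH] /=.
suff e : (bead mu x + (x == v) = bead la x + (x == v + n%:Z)%R)%N.
  by rewrite addnACA IH e addnACA.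
rewrite m; have [->|xv] := eqVneq x v.
  by rewrite bv andbF; have -> : (v == v + n%:Z) = false by lia.
have [->|xvn] := eqVneq x (v + n%:Z); first by rewrite (negbTE bvn).
by rewrite andbT orbF.
Qed.

Lemma bmove_sq v : bmove v * bmove v = 0.
Proof.
apply: endo_ext => la; rewrite endo_mulE endo_0E.
have [/andP[bv bvn]|/bmove_stuck ->] :=
    boolP (bead la v && ~~ bead la (v + n%:Z)); last first.
  by rewrite raddf0.
have [mu [-> m]] := bmove_move bv bvn.
rewrite linearZ /= bmove_stuck ?scaler0 // m eqxx andbF /=.
by have -> : (v == v + n%:Z) = false by lia.
Qed.

(** To repeat the move, position [v] must be refilled and [v + n] vacated. A single move from [w]
    would need both [w + n = v] and [w = v + n], which is impossible for positive [n]. *)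
Lemma bmove_sandwich v w : bmove v * bmove w * bmove v = 0.
Proof.
apply: endo_ext => la; rewrite !endo_mulE endo_0E.
have [/andP[bv bvn]|/bmove_stuck ->] :=
    boolP (bead la v && ~~ bead la (v + n%:Z)); last first.
  by rewrite !raddf0.
have [mu [-> m]] := bmove_move bv bvn; rewrite !linearZ /=.
have [/andP[bw bwn]|/bmove_stuck ->] :=
    boolP (bead mu w && ~~ bead mu (w + n%:Z)); last first.
  by rewrite raddf0 scaler0.
have [nu [-> m']] := bmove_move bw bwn; rewrite linearZ /=.
rewrite bmove_stuck ?scaler0 // !m' !m !eqxx andbF /=.
have -> : (v == v + n%:Z) = false by lia.
rewrite orbT /=; have [-> /=|vw] := eqVneq v (w + n%:Z).
  by have -> : (w + n%:Z + n%:Z != w) by lia.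
by [].
Qed.

(** The two moves involve four distinct positions, so neither affects whether the other is possible
    and both orders end at the same partition. Only the spin of the second move depends on the
    order, through [bcount_moved]. *)
Lemma bmove2 v w la : v != w -> v + n%:Z != w -> w + n%:Z != v ->
  (bmove v (bmove w << la >>) = 0 /\ bmove w (bmove v << la >>) = 0) \/
  exists mu c c',
  [/\ bmove v (bmove w << la >>) = q ^+ (bcount n la w + c) *: << mu >>,
      bmove w (bmove v << la >>) = q ^+ (bcount n la v + c') *: << mu >>,
      (c + (v < w < v + n%:Z)%R = bcount n la v + (v < w + n%:Z < v + n%:Z)%R)%N
    & (c' + (w < v < w + n%:Z)%R = bcount n la w + (w < v + n%:Z < w + n%:Z)%R)%N].
Proof.
move=> vw vnw wnv.
have keep (a b : int) mu nu : a != b -> a + n%:Z != b -> b + n%:Z != a ->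
    moved a mu nu ->
    (bead nu b = bead mu b) /\ (bead nu (b + n%:Z) = bead mu (b + n%:Z)).
  move=> ab anb bna m; rewrite !m bna eq_sym ab eq_sym (negbTE anb) andbT orbF.
  have -> : (b + n%:Z == a + n%:Z) = false by lia.
  by rewrite andbT orbF.
have keepl (a b : int) mu nu : a != b -> a + n%:Z != b -> b + n%:Z != a ->
    moved a mu nu ->
    ~~ (bead mu b && ~~ bead mu (b + n%:Z)) -> bmove b << nu >> = 0.
  by move=> ab anb bna /(keep a b)[] // e1 e2 h; rewrite bmove_stuck // e1 e2.
have wv : w != v by rewrite eq_sym.
have [/andP[bv bvn]|sv] :=
    boolP (bead la v && ~~ bead la (v + n%:Z)); last first.
  left; rewrite (bmove_stuck sv) raddf0; split=> //.
  have [/andP[bw bwn]|/bmove_stuck ->] :=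
      boolP (bead la w && ~~ bead la (w + n%:Z)); last first.
    by rewrite raddf0.
  have [mu [-> m]] := bmove_move bw bwn.
  by rewrite linearZ /= (keepl w v la mu) ?scaler0.
have [mu [emu m]] := bmove_move bv bvn.
have [/andP[bw bwn]|sw] :=
      boolP (bead la w && ~~ bead la (w + n%:Z)); last first.
  left; rewrite (bmove_stuck sw) raddf0; split=> //.
  by rewrite emu linearZ /= (keepl v w la mu) ?scaler0.
have [nu [enu m']] := bmove_move bw bwn.
right; rewrite emu enu !linearZ /=.
have [e1 e2] := keep v w _ _ vw vnw wnv m.
have [e3 e4] := keep w v _ _ wv wnv vnw m'.
have [mu' [-> mm]] := @bmove_move w mu ltac:(by rewrite e1) ltac:(by rewrite e2).
have [nu' [-> mm']] := @bmove_move v nu ltac:(by rewrite e3) ltac:(by rewrite e4).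
exists nu', (bcount n nu v), (bcount n mu w); rewrite !scalerA -!exprD; split=> //.
- suff -> : nu' = mu' by [].
  apply: eq_bead => x; rewrite mm mm' m m'.
  by case: (bead la x); lia.
- exact: bcount_moved.
- exact: bcount_moved.
Qed.

(** The two intervals are disjoint, so all corrections to the spins vanish. *)
Lemma bmove_far v w : v + n%:Z < w -> bmove v * bmove w = bmove w * bmove v.
Proof.
move=> vw; apply: endo_ext => la; rewrite !endo_mulE.
have [d1 d2 d3] : [/\ v != w, v + n%:Z != w & w + n%:Z != v] by split; lia.
have [[-> ->]//|[mu [c [c' [-> -> h h']]]]] := bmove2 la d1 d2 d3.
by congr (_ ^+ _ *: _); lia.
Qed.

(** Moving [a] first puts one more bead in the way of [b], whereas moving [b] first takes one out of
    the way of [a]; the total spins differ by two. *)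
Lemma bmove_near a b (f : fock K) : a < b < a + n%:Z ->
  bmove b (bmove a f) = q ^+ 2 *: bmove a (bmove b f).
Proof.
move=> ab; transitivity ((bmove b * bmove a) f) => //.
transitivity (q ^+ 2 *: (bmove a * bmove b) f) => //.
rewrite (endo_expand (bmove b * _)) (endo_expand (bmove a * _)) scaler_sumr.
apply: eq_bigr => la _.
rewrite scalerA mulrC -scalerA; congr (_ *: _); rewrite !endo_mulE.
have [d1 d2 d3] : [/\ b != a, b + n%:Z != a & a + n%:Z != b] by split; lia.
have [[-> ->]|[mu [c [c' [-> -> h h']]]]] := bmove2 la d1 d2 d3.
  by rewrite scaler0.
by rewrite scalerA -exprD; congr (_ ^+ _ *: _); lia.
Qed.

(** Only [y] is moved past [x] and [z], both at distance less than [n], and the factors $q^2$ agree.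
    The pair [x], [z] is never exchanged, so distance exactly [n] is allowed. *)
Lemma bmove_xzy x y z : x < y < z -> z <= x + n%:Z ->
  bmove x * bmove z * bmove y = bmove y * bmove x * bmove z.
Proof.
move=> xyz zx; apply/endoP => f; rewrite !endo_mulE.
by rewrite (@bmove_near y z) ?linearZ ?(@bmove_near x y) //=; lia.
Qed.

Lemma bmove_yzx x y z : x < y < z -> z <= x + n%:Z ->
  bmove y * bmove z * bmove x = bmove z * bmove x * bmove y.
Proof.
move=> xyz zx; apply/endoP => f; rewrite !endo_mulE.
have q20 : q ^+ 2 != 0 by rewrite expf_neq0.
(* Scaling by $q^2$ lets both exchanges be used in the direction of [bmove_near]; cancelling it
   requires [q] to be nonzero. *)
apply: (scalerI q20); rewrite -(@bmove_near y z) ?(@bmove_near x y) ?linearZ //=; lia.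
Qed.

End Relations.

(** * Reduction to finite alphabets *)

Definition shift_word (N : nat) (w : seq nat) : seq int :=
  [seq i%:Z - N%:Z | i <- w].

Lemma shift_word_inj N : injective (shift_word N).
Proof. by apply: inj_map => x y; lia. Qed.

Lemma sorted_shift_word N w : sorted >%R (shift_word N w) = sorted gtn w.
Proof. by rewrite sorted_map; apply: eq_sorted => x y /=; lia. Qed.

Lemma unshift_word (N : nat) (v : seq int) :
  sorted >%R v -> (forall i, i \in v -> (`|i| < N)%N) ->
  exists2 w, w \in dwords (size v) (N + N) & v = shift_word N w.
Proof.
move=> so bnd; have e : v = shift_word N [seq absz (i + N%:Z) | i <- v].
  rewrite /shift_word -map_comp -[LHS]map_id; apply/eq_in_map => i /bnd /=; lia.
exists [seq absz (i + N%:Z) | i <- v] => //.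
rewrite mem_dwords size_map eqxx -(sorted_shift_word N) -e so /=.
by rewrite all_map; apply/allP => i /bnd /=; lia.
Qed.

Lemma letters_bounded (S : set (seq int)) : finite_set S ->
  exists N, forall w, S w -> forall i, i \in w -> (`|i| < N)%N.
Proof.
move=> /finite_seqP[s ->]; exists (\max_(i <- flatten s) `|i|%N).+1 => w ws i iw.
rewrite ltnS; apply: (@leq_bigmax_seq _ _ xpredT (fun i : int => `|i|%N)) => //.
by apply/flattenP; exists w.
Qed.

Lemma endo_sumE (K : fieldType) (I : Type) (r : seq I) (F : I -> endo (fock K)) x :
  (\sum_(i <- r) F i) x = \sum_(i <- r) F i x.
Proof.
by elim: r => [|i r IH]; rewrite ?big_nil ?big_cons // endo_addE IH.
Qed.

Section Truncation.
Variables (K : fieldType) (q : K) (n : nat).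

(* The letters [0 <= i < 2 N] stand for the diagonals [-N <= i - N < N]. *)
Definition letter (N i : nat) : endo (fock K) := u_op q n (i%:Z - N%:Z).

Lemma u_word_shift N w : u_word q n (shift_word N w) = uw (letter N) w.
Proof. by rewrite /u_word /uw big_map. Qed.

(** On each basis vector only finitely many words act nontrivially, so some bound on letters covers
    them all, and a larger bound adds only zero terms. The finite support of [x] then gives a common
    bound. *)
Lemma opsum_truncate (T : choiceType) (A : set T) (wd : T -> seq int)
    (L : nat -> seq (seq nat)) :
  injective wd ->
  (forall x, finite_set [set t | u_word q n (wd t) x != 0]%classic) ->
  (forall N, uniq (L N)) ->
  (forall N w, w \in L N -> exists2 t, A t & wd t = shift_word N w) ->
  (forall N t, A t -> (forall i, i \in wd t -> (`|i| < N)%N) ->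
     exists2 w, w \in L N & wd t = shift_word N w) ->
  forall x, exists N0, forall N, (N0 <= N)%N ->
    opsum A (fun t => u_word q n (wd t)) x =
    (\sum_(w <- L N) uw (letter N) w) x.
Proof.
move=> wd_inj fin uL LA AL.
have basis la : exists N0, forall N, (N0 <= N)%N ->
    opsum A (fun t => u_word q n (wd t)) << la >> =
    (\sum_(w <- L N) uw (letter N) w) << la >>.
  have [N0 bnd] := letters_bounded (finite_image wd (fin << la >>)).
  exists N0 => N N0N; rewrite /opsum linextE endo_sumE.
  have inj' : {in A &, injective wd} by move=> t t' _ _; exact: wd_inj.
  rewrite -(fsbig_image A wd (fun w => u_word q n w << la >>) inj').
  rewrite (fsbigE [seq shift_word N w | w <- L N]) /=; first last.
  (* A word missing from the finite list has a letter outside the bound, hence kills the basis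
     vector. *)
  - move=> _ [t At <-] tL; apply: contraNeq tL => tn0.
    have [|w wL ->] := AL N t At; last by apply: map_f.
    by move=> i it; apply: leq_trans N0N; apply: bnd it; exists t.
  - by move=> _ /= /mapP[w /LA[t At <-] ->]; exists t.
  - by rewrite map_inj_uniq //; exact: shift_word_inj.
  rewrite big_map big_seq_cond [RHS]big_seq; apply: eq_big => [w|w _].
    apply: andb_idr => wL; rewrite inE; have [t At <-] := LA N w wL.
    by exists t.
  by rewrite u_word_shift.
move=> x.
have [N0 N0P] : exists N0, forall N la, (N0 <= N)%N -> la \in (msupp x : seq _) ->
    opsum A (fun t => u_word q n (wd t)) << la >> =
    (\sum_(w <- L N) uw (letter N) w) << la >>.
  elim: (msupp x : seq intpart) => [|la s [N0 IH]]; first by exists 0%N.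
  have [N1 N1P] := basis la; exists (N0 + N1)%N => N mu NN.
  rewrite inE => /orP[/eqP ->|]; first by apply: N1P; lia.
  by apply: IH; lia.
exists N0 => N NN; rewrite endo_expand [RHS]endo_expand.
by rewrite big_seq [RHS]big_seq; apply: eq_bigr => la ls; rewrite (N0P N la NN ls).
Qed.

Lemma h_nat_truncate (k : nat) (x : fock K) :
  exists N0, forall N, (N0 <= N)%N ->
    h_nat q n k x = hfin (letter N) k (N + N) x.
Proof.
have sortE (t : seq int) : sorted <%R t = sorted >%R (rev t).
  by rewrite rev_sorted; apply: eq_sorted.
apply: opsum_truncate => [t t' /(can_inj revK)/val_inj //|y|N|N w|N t].
- exact: h_nat_locally_finite.
- exact: dwords_uniq.
- rewrite mem_dwords => /and3P[/eqP sw so _].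
  have st : size (rev (shift_word N w)) == k by rewrite size_rev size_map sw.
  exists (Tuple st); last by rewrite /= revK.
  by rewrite /= sortE revK sorted_shift_word.
- rewrite /= sortE => so bnd; have [w] := unshift_word so bnd.
  by rewrite size_rev size_tuple; exists w.
Qed.

(** The conditions compare entries or differences of entries, so they are invariant under the shift
    by [N]. *)
Lemma n_commutingE (s N : nat) (T : filling s) (w w' : seq nat) : (2 <= s)%N ->
  rev T.1 = shift_word N w -> rev T.2 = shift_word N w' ->
  n_commuting n T <->
  [/\ sorted >%R (rev T.1), sorted >%R (rev T.2) & ncw n w w'].
Proof.
move=> s2 e1 e2.
have sw : size w = s.
  by have := congr1 size e1; rewrite size_rev size_tuple size_map.
have sw' : size w' = 2%N.
  by have := congr1 size e2; rewrite size_rev size_tuple size_map.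
have ent (v : seq int) u j : rev v = shift_word N u -> (j < size u)%N ->
    nth 0 v j = (nth 0%N (rev u) j)%:Z - N%:Z.
  move=> e ju; rewrite -[v]revK e /shift_word -map_rev.
  by rewrite (nth_map 0%N) ?size_rev.
have E11 : entry T 1 1 = (nth 0%N (rev w) 0)%:Z - N%:Z.
  by rewrite /entry /= (ent _ w) // sw; lia.
have E12 : entry T 1 2 = (nth 0%N (rev w) 1)%:Z - N%:Z.
  by rewrite /entry /= (ent _ w) // sw; lia.
have E21 : entry T 2 1 = (nth 0%N (rev w') 0)%:Z - N%:Z.
  by rewrite /entry /= (ent _ w') // sw'.
have E22 : entry T 2 2 = (nth 0%N (rev w') 1)%:Z - N%:Z.
  by rewrite /entry /= (ent _ w') // sw'.
have so1 : sorted >%R (rev T.1) <->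
    (forall y, (1 <= y < s)%N -> entry T 1 y < entry T 1 y.+1).
  rewrite rev_sorted; split=> [/(sortedP 0) h [|y] // ys|h].
    by apply: h; rewrite size_tuple.
  by apply/(sortedP 0) => i; rewrite size_tuple => /(h i.+1).
have so2 : sorted >%R (rev T.2) <-> entry T 2 1 < entry T 2 2.
  rewrite rev_sorted; split=> [/(sortedP 0) h|h].
    by apply: (h 0%N); rewrite size_tuple.
  by apply/(sortedP 0) => -[|i]; rewrite size_tuple.
split=> [[[/so1 h1 /so2 h2] h3 h4]|[/so1 h1 h2 h3]].
  split=> //; rewrite /ncw /ncb; move: h3 h4; rewrite E11 E12 E21 E22; lia.
split; [by split=> //; apply/so2| |];
  by move: h3; rewrite /ncw /ncb ?E11 E12 ?E21 E22; lia.
Qed.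

Lemma n_commuting_truncate (s : nat) (x : fock K) : (2 <= s)%N ->
  exists N0, forall N, (N0 <= N)%N ->
    opsum [set T : filling s | n_commuting n T]%classic
      (fun T => u_word q n (reading T)) x =
    ncfin n (letter N) s (N + N) (N + N) x.
Proof.
move=> s2.
pose L N := [seq w ++ w' | w <- dwords s (N + N),
  w' <- [seq w' <- dwords 2 (N + N) | ncw n w w']].
suff [N0 N0P] : exists N0, forall N, (N0 <= N)%N ->
    opsum [set T : filling s | n_commuting n T]%classic
      (fun T => u_word q n (reading T)) x =
    (\sum_(w <- L N) uw (letter N) w) x.
  exists N0 => N NN; rewrite (N0P N NN).
  suff -> : \sum_(w <- L N) uw (letter N) w = ncfin n (letter N) s (N + N) (N + N) by [].
  rewrite /L big_allpairs_dep; apply: eq_bigr => w _; rewrite big_filter.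
  by apply: eq_bigr => w' _; rewrite /uw big_cat.
apply: opsum_truncate => [|y|N|N v|N T].
- move=> [a b] [a' b'] /eqP; rewrite /reading /= eqseq_cat ?size_rev ?size_tuple //.
  by move=> /andP[/eqP/(can_inj revK)/val_inj -> /eqP/(can_inj revK)/val_inj ->].
- exact: reading_locally_finite.
- apply: allpairs_uniq_dep => [|w _|]; rewrite ?filter_uniq ?dwords_uniq //.
  move=> _ _ /allpairsPdep[w [w' [+ _ ->]]] /allpairsPdep[v [v' [+ _ ->]]] /=.
  rewrite !mem_dwords => /andP[/eqP sw _] /andP[/eqP sv _] /eqP.
  by rewrite eqseq_cat ?sw // => /andP[/eqP -> /eqP ->].
- move=> /allpairsPdep[w [w' [wd]]]; rewrite mem_filter => /andP[nc wd'] ->.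
  move: (wd) (wd'); rewrite !mem_dwords.
  move=> /and3P[/eqP sw so _] /and3P[/eqP sw' so' _].
  have st : size (rev (shift_word N w)) == s by rewrite size_rev size_map sw.
  have st' : size (rev (shift_word N w')) == 2 by rewrite size_rev size_map sw'.
  exists (Tuple st, Tuple st'); last by rewrite /reading /= !revK /shift_word map_cat.
  apply/(n_commutingE (w := w) (w' := w') (N := N)); rewrite //= ?revK //.
  by rewrite !sorted_shift_word.
- move=> nc bnd.
  have so : sorted >%R (rev T.1) /\ sorted >%R (rev T.2).
    move: nc => [[so1 so2] _ _]; rewrite !rev_sorted; split.
      by apply/(sortedP 0) => i; rewrite size_tuple => /(so1 i.+1).
    by apply/(sortedP 0) => -[|i]; rewrite size_tuple.
  have [|w wd ew] := @unshift_word N (rev T.1) so.1.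
    by move=> i iT; apply: bnd; rewrite mem_cat iT.
  have [|w' wd' ew'] := @unshift_word N (rev T.2) so.2.
    by move=> i iT; apply: bnd; rewrite mem_cat iT orbT.
  rewrite size_rev size_tuple in wd; rewrite size_rev size_tuple in wd'.
  exists (w ++ w'); last by rewrite /reading ew ew' /shift_word map_cat.
  apply/allpairsPdep; exists w, w'; split=> //; rewrite mem_filter wd' andbT.
  by have /(n_commutingE s2 ew ew')[] := nc.
Qed.

End Truncation.

(** In a noncommutative ring the factors stay in the order of the rows. The size is only equal to
    two because in [schur] it is the length of the list of parts. *)
Lemma det_mx22_leibniz (A : pzRingType) (m : nat) (F : nat -> nat -> A) : m = 2%N ->
  \det (\matrix_(i < m, j < m) F i j) =
  F 0%N 0%N * F 1%N 1%N - F 0%N 1%N * F 1%N 0%N.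
Proof.
move=> ->; rewrite /determinant (bigD1 1%g) //=.
rewrite (bigD1 (tperm ord0 ord_max)) //=; last first.
  by apply/eqP => /permP/(_ ord0); rewrite tpermL perm1.
rewrite [X in _ + (_ + X)]big1 ?addr0 => [|p /andP[p1 pt]].
  rewrite odd_perm1 odd_tperm expr0 mul1r expr1 mulN1r.
  rewrite !big_ord_recl !big_ord0 !mulr1.
  rewrite !mxE !perm1 tpermL.
  have -> : lift ord0 ord0 = ord_max :> 'I_2 by apply: val_inj.
  by rewrite tpermR.
have p01 : p ord0 != p ord_max by rewrite (inj_eq perm_inj).
have two (i : 'I_2) : i = ord0 \/ i = ord_max.
  by case: i => -[|[|i]] // hi; [left | right]; apply: val_inj.
have [e0|e0] := two (p ord0); have [e1|e1] := two (p ord_max).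
- by rewrite e0 e1 in p01.
- case/eqP: p1; apply/permP => i; rewrite perm1.
  by case: (two i) => ->.
- case/eqP: pt; apply/permP => i.
  by case: (two i) => ->; rewrite ?tpermL ?tpermR.
- by rewrite e0 e1 in p01.
Qed.

Lemma schur_two_rows (K : fieldType) (q : K) (n s : nat) (la : intpart) :
  q != 0 -> (0 < n)%N -> (2 <= s)%N -> val la = [:: s; 2%N] ->
  schur q n la =
  opsum [set T : filling s | n_commuting n T]%classic
        (fun T => u_word q n (reading T)).
Proof.
move=> q0 n0 hs hla.
rewrite /schur (det_mx22_leibniz (fun i j =>
  h_op q n ((part la i)%:Z - i%:Z + j%:Z))); last by rewrite hla.
transitivity (h_nat q n s * h_nat q n 2 - h_nat q n s.+1 * h_nat q n 1).
  by rewrite /part hla /= !addn0 (addn1 s).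
apply/endoP => x; rewrite endo_addE endo_oppE !endo_mulE /=.
have [N1 e1] := h_nat_truncate q n 2 x.
(* The right factor acts first, so the bound for the left factor is taken at the vector already
   produced by the right one. *)
have [N2 e2] := h_nat_truncate q n s (h_nat q n 2 x).
have [N3 e3] := h_nat_truncate q n 1 x.
have [N4 e4] := h_nat_truncate q n s.+1 (h_nat q n 1 x).
have [N5 e5] := n_commuting_truncate q n x hs.
pose N := (N1 + N2 + N3 + N4 + N5)%N.
rewrite (e2 N) ?(e4 N) ?(e1 N) ?(e3 N) ?(e5 N) /N; try lia.
(* A head on diagonal [i - N] puts the new bead at [i - N + 1], so the old one was [n] positions
   lower. *)
have letterE i : letter q n N i = bmove q n (i%:Z - N%:Z + 1 - n%:Z).
  by congr u_op; lia.
suff e : hfin (letter q n N) s (N + N) * hfin (letter q n N) 2 (N + N) =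
    ncfin n (letter q n N) s (N + N) (N + N) +
    hfin (letter q n N) s.+1 (N + N) * hfin (letter q n N) 1 (N + N).
  have := congr1 (fun f : endo _ => f x) e.
  by rewrite endo_addE !endo_mulE => ->; rewrite addrK.
apply: hfin_ncfin => // [i|i j|i j ij|a b c abc ca|a b c abc ca].
- by rewrite !letterE bmove_sq.
- by rewrite !letterE bmove_sandwich.
- by rewrite !letterE bmove_far //; lia.
- by rewrite !letterE bmove_xzy //; lia.
- by rewrite !letterE bmove_yzx //; lia.
Qed.

Local Close Scope ring_scope.

Theorem theorem7p5 (R : realType) (n : nat) (hn : (1 <= n)%N)
  (s : nat) (hs : (2 <= s)%N) (la : intpart) (hla : val la = [:: s; 2]) :
  schur (qvar R) n la =
  opsum [set T : filling s | n_commuting n T]%classic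
        (fun T => u_word (qvar R) n (reading T)).
Proof.
by apply: schur_two_rows; rewrite // /qvar tofrac_eq0 polyX_eq0.
Qed.
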